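(* Let $k$ be a positive integer. Then $d_k(G_{\infty,\infty})=2k^2+2k+1$. Therefore the two-dimensional infinite grid graph $G_{\infty,\infty}$ is $k$-distance domatically-full, i.e. $d_k(G_{\infty,\infty})=\delta_k(G_{\infty,\infty})$.
   Context: $G_{\infty,\infty}$ is the infinite graph with vertex set $\mathbb{Z}^2$, with $(a,b)$ and $(c,d)$ adjacent iff $|a-c|+|b-d|=1$. For a graph $G$, $d(x,y)$ denotes the graph distance (length of a shortest path), with $d(x,x)=0$. For a positive integer $k$, $f_k(x)=|\{y\in V(G): d(x,y)\le k\}|$ (note that $x$ itself is counted), and $\delta_k(G)=\min_{x\in V(G)}f_k(x)$. A proper $k$-distance domatic coloring with $t$ colors is a map $c:V(G)\to\{1,\dots,t\}$ such that for each vertex $x$ and each color $i\in\{1,\dots,t\}$ there is a vertex $y$ with $d(x,y)\le k$ and $c(y)=i$. The $k$-distance domatic number $d_k(G)$ is the maximum $t$ for which such a coloring exists. One always has $d_k(G)\le\delta_k(G)$, and $G$ is called $k$-distance domatically-full if $d_k(G)=\delta_k(G)$. *)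

(* Defs.v *)
From mathcomp Require Import all_boot all_order all_algebra.
From mathcomp Require Import classical_sets cardinality.

Set Implicit Arguments.
Unset Strict Implicit.
Unset Printing Implicit Defensive.

Import GRing.Theory Num.Theory.

Local Open Scope classical_set_scope.
Local Open Scope nat_scope.

(* Simple graphs, possibly infinite. *)
Record sgraph := SGraph {
  vertex :> eqType;
  edge : rel vertex;
  edge_sym : symmetric edge;
  edge_irr : irreflexive edge
}.

Section Domatic.

Variable G : sgraph.

(* A path of length n from x to y, with pairwise distinct vertices x :: p. *)
Definition has_path (x y : G) (n : nat) : Prop :=
  exists p : seq G,
    [/\ path (@edge G) x p, uniq (x :: p), last x p = y & size p = n].

(* d(x, y) = n. Distance is a relation because no n exists when x and y lie in
   different components. *)
Definition is_dist (x y : G) (n : nat) : Prop :=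
  has_path x y n /\ forall m, has_path x y m -> n <= m.

(* d(x, y) <= k *)
Definition dist_le (x y : G) (k : nat) : Prop :=
  exists2 n, is_dist x y n & n <= k.

(* f_k(x) = n; no n exists when the ball is infinite. *)
Definition is_ball_card (k : nat) (x : G) (n : nat) : Prop :=
  ([set y : G | dist_le x y k] #= `I_n)%card.

(* delta_k(G) = n; vertices with an infinite ball do not affect the minimum. *)
Definition is_min_ball_card (k n : nat) : Prop :=
  (exists x : G, is_ball_card k x n) /\
  forall (x : G) (m : nat), is_ball_card k x m -> n <= m.

(* The colors 1, ..., t are represented by 'I_t. *)
Definition domatic_coloring (k t : nat) (c : G -> 'I_t) : Prop :=
  forall (x : G) (i : 'I_t), exists2 y : G, dist_le x y k & c y = i.

(* d_k(G) = t *)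
Definition is_domatic_number (k t : nat) : Prop :=
  (exists c : G -> 'I_t, domatic_coloring k c) /\
  forall s : nat, (exists c : G -> 'I_s, domatic_coloring k c) -> s <= t.

Definition domatically_full (k : nat) : Prop :=
  exists2 n, is_domatic_number k n & is_min_ball_card k n.

End Domatic.

(* `|m - n| is the nat-valued distance between the integers m and n. *)
Definition grid_edge : rel (int * int) :=
  fun p q => `|p.1 - q.1| + `|p.2 - q.2| == 1.

Lemma grid_edge_sym : symmetric grid_edge.
Proof. by move=> p q; rewrite /grid_edge distnC [X in _ + X]distnC. Qed.

Lemma grid_edge_irr : irreflexive grid_edge.
Proof. by move=> p; rewrite /grid_edge !distnn. Qed.

Definition grid : sgraph := SGraph grid_edge_sym grid_edge_irr.

(* Main.v *)
Require Import Defs.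
From mathcomp Require Import all_boot.
From mathcomp Require Import all_order all_algebra.
From mathcomp Require Import classical_sets cardinality.
From mathcomp Require Import zify.

(** Write [N = 2 k^2 + 2 k + 1].  The balls of radius [k] in the grid are the
    diamonds [|a - x| + |b - y| <= k], and everything follows from one fact: the
    linear form [w (a, b) = k a + (k + 1) b] maps the diamond centred at the
    origin bijectively onto the [N] integers [-(k^2 + k), ..., k^2 + k].

    To see this, put [s = a + b] and [e = b - a].  The diamond is the set of
    points with [|s| <= k] and [|e| <= k], and [2 w = (2 k + 1) s + e].  So [s]
    and [e] are the quotient and the remainder of [2 w] in the division by
    [2 k + 1] with remainders centred at 0, and [w] determines the point
    ([diamond_sumE]).  Conversely, if [|r| <= k^2 + k], dividing [2 r] in this
    way gives [|s| <= k]; moreover [s] and [e] have the same parity because [2 r] is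
    even and [2 k + 1] odd, so they come from an integral point
    ([diamond_weight_surj]).

    The bijection shows that every ball has [N] vertices, hence
    [delta_k = N], and a coloring in which each ball meets all the colors has at
    most [N] colors.  Conversely, color [p] by the residue of [w p] modulo [N].
    As [w] is additive, its values on the ball around [p] are [w p + r] with [r]
    ranging over [N] consecutive integers, so this ball meets all the [N]
    residues. *)

Set Implicit Arguments.
Unset Strict Implicit.
Unset Printing Implicit Defensive.

Import Order.TTheory GRing.Theory Num.Theory.

Local Open Scope nat_scope.

(** * Distances and balls in a graph *)

Section Graphs.

Variable G : sgraph.

(** Shortening a walk removes its repeated vertices, and the lower bound on the
    lengths of paths forbids that any be removed. *)
Lemma is_dist_walk (x y : G) (p : seq G) :
    path (@edge G) x p -> last x p = y ->
    (forall m, has_path x y m -> size p <= m) ->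
  is_dist x y (size p).
Proof.
move=> e_p; case/shortenP: e_p => q e_q Uq sub_qp last_q min_p.
have path_q : has_path x y (size q) by exists q.
have le_qp : size q <= size p.
  by apply: uniq_leq_size sub_qp; case/andP: Uq.
have <- : size q = size p by apply/eqP; rewrite eqn_leq le_qp min_p.
by split=> // m /min_p; apply: leq_trans.
Qed.

Lemma is_ball_card_inj (k : nat) (x : G) (m n : nat) :
  is_ball_card k x m -> is_ball_card k x n -> m = n.
Proof. by move=> /card_esym xm xn; apply/card_eq_II/(card_eq_trans xm). Qed.

Lemma domatic_coloring_le_ball (k t n : nat) (c : G -> 'I_t) (x : G) :
  domatic_coloring k c -> is_ball_card k x n -> t <= n.
Proof.
move=> dom_c ball_n; rewrite -card_le_II -(card_le_eqr ball_n).
rewrite (card_le_eql card_II).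
have <- : image [set y | dist_le x y k]%classic c = setT.
  by apply/seteqP; split=> // i _; case: (dom_c x i) => y xy <-; exists y.
exact: card_image_le.
Qed.

Lemma is_min_ball_card_regular (k n : nat) (x0 : G) :
  (forall x : G, is_ball_card k x n) -> is_min_ball_card G k n.
Proof.
move=> ballG; split; first by exists x0.
by move=> x m /is_ball_card_inj/(_ (ballG x)) ->.
Qed.

End Graphs.

(** * Distances in the grid *)

Definition taxicab (x y : int * int) : nat :=
  (`|x.1 - y.1| + `|x.2 - y.2|)%N.

Lemma taxicab_path (x : grid) (p : seq grid) :
  path (@edge grid) x p -> taxicab x (last x p) <= size p.
Proof.
elim: p x => [|z p IHp] x /=; first by rewrite /taxicab !distnn.
case/andP=> xz /IHp; move: xz; case: (last z p) => e f.
by case: x z => [a b] [c d]; rewrite /grid_edge /taxicab /=; lia.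
Qed.

Lemma grid_step (x y : int * int) (n : nat) :
  taxicab x y = n.+1 -> exists2 z, grid_edge x z & taxicab z y = n.
Proof.
case: x y => [a b] [c d]; rewrite /taxicab /grid_edge /= => xy.
have [lt_ac | lt_ca | eq_ac] := ltgtP a c.
- by exists (a + 1, b)%R => /=; lia.
- by exists (a - 1, b)%R => /=; lia.
have [lt_bd | lt_db | eq_bd] := ltgtP b d; last by lia.
- by exists (a, b + 1)%R => /=; lia.
- by exists (a, b - 1)%R => /=; lia.
Qed.

Lemma grid_walk (x y : grid) : exists p : seq grid,
  [/\ path (@edge grid) x p, last x p = y & size p = taxicab x y].
Proof.
move def_n: (taxicab x y) => n; elim: n x def_n => [|n IHn] x.
  case: x y => [a b] [c d]; rewrite /taxicab /= => xy.
  by exists [::]; split=> //=; congr pair; lia.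
case/grid_step=> z xz /IHn[p [zp last_p size_p]].
by exists (z :: p); split; rewrite //= ?size_p // xz.
Qed.

Lemma grid_dist_le (x y : grid) (k : nat) :
  dist_le x y k <-> taxicab x y <= k.
Proof.
have path_ge m : has_path x y m -> taxicab x y <= m.
  by case=> p [xp _ <- <-]; apply: taxicab_path.
split=> [[n [/path_ge le_n _]] | le_k]; first exact: leq_trans.
exists (taxicab x y) => //.
have [p [xp last_p size_p]] := grid_walk x y.
by rewrite -size_p; apply: is_dist_walk => //; rewrite size_p.
Qed.

(** * A linear form enumerating the diamond *)

Definition weight (k : nat) (v : int * int) : int :=
  (k%:Z * v.1 + k.+1%:Z * v.2)%R.

Lemma weightD (k : nat) (u v : int * int) :
  weight k (u.1 + v.1, u.2 + v.2)%R = (weight k u + weight k v)%R.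
Proof. by rewrite /weight /=; lia. Qed.

(** The diamond becomes a square in the coordinates [a + b] and [b - a]. *)
Lemma diamondE (k : nat) (a b : int) : (`|a| + `|b| <= k)%N =
  (- k%:Z <= a + b <= k%:Z)%R && (- k%:Z <= b - a <= k%:Z)%R.
Proof. by lia. Qed.

Lemma double_weight (k : nat) (a b : int) :
  (2 * weight k (a, b) = (a + b) * (2 * k%:Z + 1) + (b - a))%R.
Proof. by rewrite /weight /=; lia. Qed.

Lemma diamond_weight_bound (k : nat) (a b : int) : (`|a| + `|b| <= k)%N ->
  (- (k%:Z * k%:Z + k%:Z) <= weight k (a, b) <= k%:Z * k%:Z + k%:Z)%R.
Proof.
rewrite diamondE => /andP[s_k e_k]; have := double_weight k a b.
by nia.
Qed.

(** The shift by [k] turns the centred remainder [b - a] into a Euclidean one,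
    between 0 and [2 k]. *)
Lemma diamond_sumE (k : nat) (a b : int) : (`|a| + `|b| <= k)%N ->
  (a + b = (2 * weight k (a, b) + k%:Z) %/ (2 * k%:Z + 1))%Z%R.
Proof.
rewrite diamondE => /andP[_ e_k]; rewrite double_weight -addrA.
rewrite divzMDl; last by lia.
by rewrite divz_small ?addr0 //; lia.
Qed.

Lemma diamond_weight_inj (k : nat) (a b c d : int) :
    (`|a| + `|b| <= k)%N -> (`|c| + `|d| <= k)%N ->
  weight k (a, b) = weight k (c, d) -> (a, b) = (c, d).
Proof.
move=> /diamond_sumE s_ab /diamond_sumE s_cd eq_w.
have eq_s : (a + b = c + d)%R by rewrite s_ab s_cd eq_w.
have := double_weight k a b; rewrite eq_w double_weight eq_s => eq_e.
by congr pair; lia.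
Qed.

(** With [s] the centred quotient of [2 r] by [2 k + 1], the equations
    [a + b = s] and [k a + (k + 1) b = r] have the integral solution below. *)
Lemma diamond_weight_surj (k : nat) (r : int) :
    (- (k%:Z * k%:Z + k%:Z) <= r <= k%:Z * k%:Z + k%:Z)%R ->
  exists2 v : int * int, (`|v.1| + `|v.2| <= k)%N & weight k v = r.
Proof.
move=> r_bound; set m := (2 * k%:Z + 1)%R.
have m_gt0 : (0 < m)%R by rewrite /m; lia.
have := divz_eq (2 * r + k%:Z)%R m.
have := modz_ge0 (2 * r + k%:Z)%R (lt0r_neq0 m_gt0).
have := ltz_pmod (2 * r + k%:Z)%R m_gt0.
move: (divz _ _) (modz _ _) => s e; rewrite /m => lt_e ge_e def_r.
exists (k.+1%:Z * s - r, r - k%:Z * s)%R; last by rewrite /weight /=; nia.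
rewrite diamondE /=; have s_bound : (- k%:Z <= s <= k%:Z)%R by nia.
by apply/andP; split; lia.
Qed.

(** * Balls and colorings of the grid *)

Lemma grid_ball_card (k : nat) (x : grid) :
  is_ball_card k x (2 * k ^ 2 + 2 * k + 1).
Proof.
case: x => a b; apply/card_set_bijP.
exists (fun y : int * int =>
  `|(weight k (y.1 - a, y.2 - b) + (k%:Z * k%:Z + k%:Z))%R|%N).
have ballE c d : dist_le ((a, b) : grid) (c, d) k <->
    (`|(c - a)%R| + `|(d - b)%R| <= k)%N.
  by rewrite grid_dist_le /taxicab /=; split; lia.
split.
- move=> [c d] /ballE/diamond_weight_bound /=; lia.
- move=> [c d] [c' d'] /set_mem/ballE v_k /set_mem/ballE v'_k /= eq_w.
  have := diamond_weight_bound v_k; have := diamond_weight_bound v'_k.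
  move=> bound' bound.
  suff /(diamond_weight_inj v_k v'_k)[] : weight k (c - a, d - b)%R =
    weight k (c' - a, d' - b)%R by move=> *; congr pair; lia.
  by move: eq_w bound bound'; move: (weight _ _) (weight _ _) => u u'; lia.
move=> n /= n_lt.
have [|v v_k def_n] := @diamond_weight_surj k (n%:Z - (k%:Z * k%:Z + k%:Z))%R.
  by lia.
exists (a + v.1, b + v.2)%R => /=.
  by apply/ballE; rewrite ![(_ + v.1)%R]addrC ![(_ + v.2)%R]addrC !addrK.
rewrite ![(_ + v.1)%R]addrC ![(_ + v.2)%R]addrC !addrK -surjective_pairing.
by rewrite def_n subrK.
Qed.

Lemma grid_domatic_coloring (k : nat) :
  exists c : grid -> 'I_(2 * k ^ 2 + 2 * k + 1), domatic_coloring k c.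
Proof.
rewrite addn1; set N := (2 * k ^ 2 + 2 * k).+1.
have N_gt0 : (0 < N%:Z)%R by [].
have N_neq0 := lt0r_neq0 N_gt0.
exists (fun p => inord `|(weight k p %% N%:Z)%Z|%N) => p i.
(* [r] is the residue of [i - weight k p] closest to 0. *)
pose M := (k%:Z * k%:Z + k%:Z)%R.
pose r := (((i%:Z - weight k p + M) %% N%:Z)%Z - M)%R.
have [|v v_k def_r] := @diamond_weight_surj k r.
  have := modz_ge0 (i%:Z - weight k p + M)%R N_neq0.
  have := ltz_pmod (i%:Z - weight k p + M)%R N_gt0.
  by rewrite /r /M /N; lia.
exists (p.1 + v.1, p.2 + v.2)%R.
  by apply/grid_dist_le; rewrite /taxicab /=; lia.
rewrite weightD def_r addrCA.
have -> : (((i%:Z - weight k p + M) %% N%:Z)%Z + (weight k p - M)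
             = i%:Z %[mod N%:Z])%Z%R.
  by rewrite modzDml; congr modz; lia.
by rewrite modz_small ?ltz_nat ?ltn_ord // absz_nat inord_val.
Qed.

Theorem theorem7p1 (k : nat) (hk : 0 < k) :
  is_domatic_number grid k (2 * k ^ 2 + 2 * k + 1) /\ domatically_full grid k.
Proof.
have domatic : is_domatic_number grid k (2 * k ^ 2 + 2 * k + 1).
  split=> [|t [c dom_c]]; first exact: grid_domatic_coloring.
  exact: domatic_coloring_le_ball dom_c (grid_ball_card k (0, 0)%R).
split=> //; exists (2 * k ^ 2 + 2 * k + 1) => //.
by apply: (is_min_ball_card_regular ((0, 0)%R : grid)) => x; apply: grid_ball_card.
Qed.
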